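(* Let $n\ge 3$ be an integer. Then $dyn_3(C_n\Box K_n)=n+1$.
   Context: $C_n$ is the cycle and $K_n$ the complete graph on $n$ vertices; $G\Box H$ is the Cartesian product (vertex set $V(G)\times V(H)$, $(u,v)\sim(u',v')$ iff $u=u'$ and $vv'\in E(H)$, or $v=v'$ and $uu'\in E(G)$). For constant threshold $t$, a set $D$ of vertices is a $t$-dynamic monopoly if starting from $D$ and repeatedly adding any vertex having at least $t$ neighbors in the current set eventually yields all vertices; $dyn_t(G)$ is the minimum size of a $t$-dynamic monopoly of $G$. *)

(* Defs.v *)
From mathcomp Require Import all_boot.

Set Implicit Arguments.
Unset Strict Implicit.
Unset Printing Implicit Defensive.

Record sgraph := SGraph {
  vertex : finType;
  adj : rel vertex;
  adj_sym : symmetric adj;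
  adj_irrefl : irreflexive adj
}.

(* The conjunct i != j matters only for n = 1, where i.+1 %% n = i. *)
Definition cycle_adj (n : nat) : rel 'I_n :=
  [rel i j : 'I_n |
    (i != j) && ((j == i.+1 %% n :> nat) || (i == j.+1 %% n :> nat))].

Lemma cycle_adj_sym (n : nat) : symmetric (@cycle_adj n).
Proof. by move=> i j; rewrite /cycle_adj /= eq_sym orbC. Qed.

Lemma cycle_adj_irrefl (n : nat) : irreflexive (@cycle_adj n).
Proof. by move=> i; rewrite /cycle_adj /= eqxx. Qed.

Definition cycle_graph (n : nat) : sgraph :=
  SGraph (@cycle_adj_sym n) (@cycle_adj_irrefl n).

Definition complete_adj (n : nat) : rel 'I_n := [rel i j : 'I_n | i != j].

Lemma complete_adj_sym (n : nat) : symmetric (@complete_adj n).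
Proof. by move=> i j; rewrite /complete_adj /= eq_sym. Qed.

Lemma complete_adj_irrefl (n : nat) : irreflexive (@complete_adj n).
Proof. by move=> i; rewrite /complete_adj /= eqxx. Qed.

Definition complete_graph (n : nat) : sgraph :=
  SGraph (@complete_adj_sym n) (@complete_adj_irrefl n).

Definition cartesian_adj (G H : sgraph) : rel (vertex G * vertex H)%type :=
  [rel x y : vertex G * vertex H |
    ((x.1 == y.1) && adj x.2 y.2) || ((x.2 == y.2) && adj x.1 y.1)].

Lemma cartesian_adj_sym (G H : sgraph) : symmetric (@cartesian_adj G H).
Proof.
move=> x y; rewrite /cartesian_adj /= (eq_sym x.1) (eq_sym x.2).
by rewrite (adj_sym x.1) (adj_sym x.2).
Qed.

Lemma cartesian_adj_irrefl (G H : sgraph) : irreflexive (@cartesian_adj G H).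
Proof. by move=> x; rewrite /cartesian_adj /= !adj_irrefl !andbF. Qed.

Definition cartesian_product (G H : sgraph) : sgraph :=
  SGraph (@cartesian_adj_sym G H) (@cartesian_adj_irrefl G H).

(* One step of the process: B is A together with one new vertex that has at
   least t neighbours in A. *)
Definition activation (t : nat) (G : sgraph) : rel {set vertex G} :=
  [rel A B : {set vertex G} | [exists v : vertex G,
    [&& v \notin A, t <= #|[set u in A | adj v u]| & B == v |: A]]].

Definition dynamic_monopoly (t : nat) (G : sgraph) (D : {set vertex G}) : bool :=
  connect (@activation t G) D [set: vertex G].

(* The default value of the arg min, the full vertex set, is always a
   t-dynamic monopoly, so the minimum ranges over a nonempty family. *)
Lemma dynamic_monopolyT (t : nat) (G : sgraph) :
  dynamic_monopoly t [set: vertex G].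
Proof. exact: connect0. Qed.

Definition dyn (t : nat) (G : sgraph) : nat :=
  #|[arg min_(D < [set: vertex G] | dynamic_monopoly t D) #|D|]|.

(* Main.v *)
Require Import Defs.
From mathcomp Require Import all_boot.
From mathcomp Require Import zify.

(** Call the copy of [K_n] over a vertex [i] of the cycle the layer of [i].  A
    vertex has only two neighbours outside its layer, so a layer without seeds
    stays inactive and a dynamic monopoly meets every layer.  If it met every
    layer exactly once, then the process would preserve the following property:
    every layer contains one active vertex, or two active vertices whose columns
    include all active columns of the adjacent layers.  No layer would then be
    filled, as [n >= 3].  Hence [n + 1] seeds are needed.

    Conversely take the diagonal and the vertex [(0, 2)].  Layer [0] has two
    seeds and gains [(0, 1)] from [(1, 1)], so it fills; after layer [i] is full,
    [(i + 1, i + 2)] has the active neighbours [(i, i + 2)], [(i + 1, i + 1)] and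
    [(i + 2, i + 2)], so layer [i + 1] fills as well; the last layer lies between
    two full layers. *)

Set Implicit Arguments.
Unset Strict Implicit.
Unset Printing Implicit Defensive.

(** * Activation sequences and closed sets *)

Section Process.

Variables (t : nat) (G : sgraph).
Implicit Types A D : {set vertex G}.

(** Serves both invariants of the lower bound: an empty layer, and [sparse]. *)
Lemma connect_activation_ind (P : {set vertex G} -> Prop) A B :
  (forall C v, P C -> v \notin C -> t <= #|[set u in C | adj v u]| ->
     P (v |: C)) ->
  P A -> connect (@activation t G) A B -> P B.
Proof.
move=> stepP PA /connectP[p + ->].
elim: p A PA => [|C p IHp] A PA //= /andP[/existsP[v /and3P[vA tv /eqP->]]].
by apply: IHp; apply: stepP.
Qed.

(** Activating eligible vertices one at a time shrinks the complement, so the process stops, and it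
    stops at a closed set. No explicit activation order is then needed in the construction. *)
Lemma closed_dynamic_monopoly D :
  (forall A, D \subset A ->
     (forall v, t <= #|[set u in A | adj v u]| -> v \in A) -> A = setT) ->
  dynamic_monopoly t D.
Proof.
move=> closedT; rewrite /dynamic_monopoly.
have [k] := ubnP #|~: D|; elim: k => // k IHk in D closedT *; rewrite ltnS => Dk.
case: (pickP [pred v | (v \notin D) && (t <= #|[set u in D | adj v u]|)]).
- move=> v /andP[/= vD tv]; apply: (@connect_trans _ _ (v |: D)).
    by apply: connect1; apply/existsP; exists v; rewrite vD tv eqxx.
  apply: IHk => [A /(subset_trans (subsetUr _ _))|]; first exact: closedT.
  apply: leq_trans Dk; apply: proper_card; rewrite properE setCS subsetUr /=.
  by apply/subsetPn; exists v; rewrite !inE ?eqxx.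
- move=> noact; rewrite (closedT D) ?connect0 // => v tv.
  by move: (noact v); rewrite /= tv andbT => /negbFE.
Qed.

Lemma dyn_eq m D :
  dynamic_monopoly t D -> #|D| = m ->
  (forall A, dynamic_monopoly t A -> m <= #|A|) -> dyn t G = m.
Proof.
move=> Dmono Dm minm; rewrite /dyn; case: arg_minnP => [|A Amono Amin].
  exact: dynamic_monopolyT.
by apply/eqP; rewrite eqn_leq minm // -Dm Amin.
Qed.

End Process.

(** * Lower bound, for any first factor of maximum degree at most 2 *)

Section Layers.

Variables (G : sgraph) (n : nat).
Hypothesis degG : forall i : vertex G, #|[set k | adj i k]| <= 2.
Local Notation GK := (cartesian_product G (complete_graph n)).
Implicit Types (A D : {set vertex GK}) (i k : vertex G) (j : 'I_n).

Definition layer A i : {set 'I_n} := [set j | (i, j) \in A].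

Lemma layerU i j A k :
  layer ((i, j) |: A) k = if k == i then j |: layer A i else layer A k.
Proof.
apply/setP=> l; have [->|/negPf ki] := eqVneq k i; rewrite !inE xpair_eqE.
  by rewrite eqxx.
by rewrite ki.
Qed.

Lemma card_layers A : #|A| = \sum_i #|layer A i|.
Proof.
rewrite -sum1_card (eq_bigr (fun i => \sum_(j | (i, j) \in A) 1)) => [|i _].
  by rewrite pair_big_dep /=; apply: eq_bigl => -[].
by rewrite -sum1_card; apply: eq_bigl => j; rewrite inE.
Qed.

(** A neighbour shares either the layer or the column. This is only a bound, since [layer A i] also
    counts [j] when [(i, j)] is active. *)
Lemma card_adj_layer A i j :
  #|[set u in A | @adj GK (i, j) u]| <=
    #|layer A i| + #|[set k | adj i k & j \in layer A k]|.
Proof.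
set K := [set k | adj i k & _].
have pairl_inj : injective (pair i : 'I_n -> vertex GK) by move=> ? ? [].
have pairr_inj : injective (pair^~ j : vertex G -> vertex GK) by move=> ? ? [].
rewrite -(card_imset _ pairl_inj) -[#|K|](card_imset _ pairr_inj).
apply: leq_trans (leq_card_setU _ _); apply: subset_leq_card.
apply/subsetP=> -[k l]; rewrite !inE /= => /andP[klA].
case/orP=> /andP[/eqP/= kl adjkl]; apply/orP; [left|right]; apply/imsetP.
  by exists l; rewrite ?kl //= !inE.
by exists k; rewrite ?kl //= !inE adjkl kl.
Qed.

Lemma card_adj_col A i j : #|[set k | adj i k & j \in layer A k]| <= 2.
Proof.
apply: leq_trans (degG i); apply: subset_leq_card.
by apply/subsetP=> k; rewrite !inE => /andP[].
Qed.

Lemma dynamic_monopoly_layer_neq0 D i :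
  0 < n -> dynamic_monopoly 3 D -> layer D i != set0.
Proof.
move=> n_gt0 Dmono; apply/eqP=> Di0.
suff /setP/(_ (Ordinal n_gt0)) : layer [set: vertex GK] i = set0 by rewrite !inE.
pattern [set: vertex GK]; apply: connect_activation_ind Di0 Dmono => C [k j] Ci0 _ act3.
rewrite layerU; have [ik|//] := eqVneq i k; move: act3; rewrite -ik.
move/leq_trans/(_ (card_adj_layer _ _ _)).
by rewrite Ci0 cards0 ltnNge card_adj_col.
Qed.

Definition sparse A := forall i,
  #|layer A i| = 1 \/
  #|layer A i| = 2 /\ (forall k, adj i k -> layer A k \subset layer A i).

Lemma sparse_activation A v :
  sparse A -> v \notin A -> 3 <= #|[set u in A | @adj GK v u]| ->
  sparse (v |: A).
Proof.
case: v => i j spA; move=> ijA /leq_trans/(_ (card_adj_layer _ _ _)).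
have jAi : j \notin layer A i by rewrite inE.
set K := [set k | adj i k & _]; have [Ai1|[Ai2 Aik]] := spA i; last first.
  (* A layer with two active vertices gains nothing: a third active neighbour would lie in an
     adjacent layer, whose columns are already active here. *)
  rewrite Ai2 (leq_add2l 2 1) => /card_gt0P[k]; rewrite inE => /andP[ik jk].
  by rewrite (subsetP (Aik k ik)) in jAi.
(* With one active vertex in the layer, two neighbours outside it are needed; by the degree bound
   these are all there are, so [j] is active in every adjacent layer. *)
rewrite Ai1 (leq_add2l 1 2) => K2.
have jAk k : adj i k -> j \in layer A k.
  move=> ik; have /eqP KE : K == [set k | adj i k].
    rewrite eqEcard (leq_trans (degG i) K2) andbT.
    by apply/subsetP=> l; rewrite !inE => /andP[].
  have : k \in K by rewrite KE inE.
  by rewrite inE => /andP[].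
have neq_adj k : adj i k -> (k == i) = false.
  by move=> ik; apply/eqP=> ki; rewrite ki adj_irrefl in ik.
move=> k; rewrite layerU; have [->{k}|ki] := eqVneq k i.
  right; split=> [|k ik]; first by rewrite cardsU1 jAi Ai1.
  (* The adjacent layer contains [j]. If it has one active vertex, it is [j]; if two, it also
     contains [layer A i] and equals the enlarged layer by cardinality. *)
  rewrite layerU neq_adj //; have [Ak1|[Ak2 sub]] := spA k.
    have /cards1P[l Al] : #|layer A k| == 1 by rewrite Ak1.
    by have := jAk k ik; rewrite Al inE => /eqP->; apply: subsetUl.
  suff /eqP<- : j |: layer A i == layer A k by [].
  rewrite eqEcard cardsU1 jAi Ai1 Ak2 andbT subUset sub1set jAk //.
  by rewrite sub // adj_sym.
(* An unchanged layer [k] is affected only if adjacent to [i], and then it already contains the new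
   column [j]. *)
have [|[Ak2 sub]] := spA k; [by left|right; split=> // l kl].
rewrite layerU; case: eqVneq kl => [->|_] kl; last exact: sub.
by rewrite subUset sub1set jAk 1?adj_sym // sub.
Qed.

Lemma dynamic_monopoly_card_gt D :
  0 < #|vertex G| -> 2 < n -> dynamic_monopoly 3 D -> #|vertex G| < #|D|.
Proof.
case/card_gt0P=> i0 _ n_gt2 Dmono; rewrite ltnNge; apply/negP => Dle.
have Di k : 1 <= #|layer D k|.
  by rewrite card_gt0 dynamic_monopoly_layer_neq0 // (leq_trans _ n_gt2).
(* At least one seed per layer, and no more seeds than layers, force exactly one in each. *)
have spD : sparse D.
  move=> i; left; apply/eqP; rewrite eqn_leq Di andbT.
  move: Dle; rewrite card_layers -[#|vertex G|]sum1_card.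
  rewrite (bigD1 i) //= [X in _ <= X](bigD1 i) //= => Dle.
  have : \sum_(k | k != i) 1 <= \sum_(k | k != i) #|layer D k|.
    by apply: leq_sum => k _; apply: Di.
  by rewrite -(leq_add2l #|layer D i|) => /leq_trans/(_ Dle); rewrite leq_add2r.
have spT := connect_activation_ind sparse_activation spD Dmono.
have : #|layer [set: vertex GK] i0| = n.
  by rewrite -[RHS]card_ord -cardsT; congr #|pred_of_set _|; apply/setP=> j; rewrite !inE.
by case: (spT i0) => [|[]] -> => [|_] nE; rewrite -nE in n_gt2.
Qed.

End Layers.

Lemma cycle_degree n (i : vertex (cycle_graph n)) : #|[set k | adj i k]| <= 2.
Proof.
apply: (@leq_trans #|[set ordS i; ord_pred i]|); last first.
  by rewrite cards2; case: (_ != _).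
apply: subset_leq_card; apply/subsetP=> k; rewrite !inE => /andP[_].
case/orP=> /eqP ik; apply/orP; [left|right]; first exact/eqP/val_inj.
by rewrite -(inj_eq (@ordS_inj n)) ord_predK eq_sym; apply/eqP/val_inj.
Qed.

(** * Upper bound, with [n.+3] in place of the order of the cycle *)

Section Construction.

Variable n : nat.
Local Notation CK := (cartesian_product (cycle_graph n.+3) (complete_graph n.+3)).
Local Notation o := (@inord n.+2).

Definition diagonal_seed : {set vertex CK} :=
  (o 0, o 2) |: [set (i, i) | i : 'I_n.+3].

Lemma card_diagonal_seed : #|diagonal_seed| = n.+3 + 1.
Proof.
rewrite cardsU1 card_imset => [|i j []//]; rewrite card_ord addnC.
suff -> : (o 0, o 2) \notin [set (i, i) | i : 'I_n.+3] by [].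
by apply/imsetP=> -[i _ [<-]] /(congr1 val); rewrite !val_insubd.
Qed.

Lemma diagonal_seed_dynamic_monopoly : dynamic_monopoly 3 diagonal_seed.
Proof.
apply: closed_dynamic_monopoly => A /subsetP sDA closedA.
have diagA (i : 'I_n.+3) : (i, i) \in A.
  by apply: sDA; rewrite !inE; apply/orP; right; apply/imsetP; exists i.
have seedA : (o 0, o 2) \in A by apply: sDA; rewrite !inE eqxx.
have close3 (v x y z : vertex CK) : x \in A -> y \in A -> z \in A ->
    uniq [:: x; y; z] -> adj v x -> adj v y -> adj v z -> v \in A.
  move=> xA yA zA u vx vy vz; apply: closedA.
  rewrite -[3]/(size [:: x; y; z]) -(card_uniqP u); apply: subset_leq_card.
  by apply/subsetP=> w; rewrite !inE => /or3P[] /eqP->; apply/andP.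
have adjK (i j k : 'I_n.+3) : j != k -> @adj CK (i, j) (i, k).
  by move=> jk; apply/orP; left; apply/andP.
(* The bound on [k] leaves out the edge that closes the cycle, which only the last layer needs. *)
have adjS k (j : 'I_n.+3) : k < n.+2 ->
    @adj CK (o k, j) (o k.+1, j) /\ @adj CK (o k.+1, j) (o k, j).
  move=> kn; rewrite [@adj CK (o k.+1, j) _]adj_sym.
  suff adjk : @adj CK (o k, j) (o k.+1, j) by [].
  apply/orP; right; apply/andP; split=> //.
  rewrite /= /cycle_adj /= -val_eqE /= !inordK ?ltnS ?(ltnW kn) //.
  by rewrite (@modn_small k.+1) // eqxx neq_ltn ltnSn.
have neqo k l : k <= n.+2 -> l <= n.+2 -> k != l -> o k != o l.
  by move=> kn ln kl; rewrite -val_eqE /= !inordK.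
have full0 j : (o 0, j) \in A.
  have A01 : (o 0, o 1) \in A.
    apply: (close3 _ (o 0, o 0) (o 0, o 2) (o 1, o 1)); rewrite ?diagA //.
    - by rewrite /= !inE !xpair_eqE -!val_eqE /= !inordK; lia.
    - by apply: adjK; apply: neqo.
    - by apply: adjK; apply: neqo.
    - by case: (adjS 0 (o 1)).
  have [->|j0] := eqVneq j (o 0); first exact: diagA.
  have [->//|j1] := eqVneq j (o 1); have [->//|j2] := eqVneq j (o 2).
  apply: (close3 _ (o 0, o 0) (o 0, o 1) (o 0, o 2)); rewrite ?diagA ?adjK //.
  by rewrite /= !inE !xpair_eqE -!val_eqE /= !inordK; lia.
(* The last layer is excluded: the column after it would be out of range for [o]. *)
have fullS k : k < n.+2 -> forall j, (o k, j) \in A.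
  elim: k => [|k IHk] kn; first exact: full0.
  have {}IHk := IHk (ltnW kn).
  have [adj_next _] := adjS k.+1 (o k.+2) kn.
  have adj_prev j : @adj CK (o k.+1, j) (o k, j) by case: (adjS k j (ltnW kn)).
  have Ak : (o k.+1, o k.+2) \in A.
    apply: (close3 _ (o k, o k.+2) (o k.+1, o k.+1) (o k.+2, o k.+2)) => //.
    - by rewrite /= !inE !xpair_eqE -!val_eqE /= !inordK; lia.
    - by apply: adjK; apply: neqo; lia.
  move=> j; have [->|j1] := eqVneq j (o k.+1); first exact: diagA.
  have [->//|j2] := eqVneq j (o k.+2).
  (* Two active vertices in the layer and one in the full layer before it activate every other
     column. *)
  apply: (close3 _ (o k, j) (o k.+1, o k.+1) (o k.+1, o k.+2)); rewrite ?adjK //.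
  by rewrite /= !inE !xpair_eqE -!val_eqE /= !inordK; lia.
apply/setP=> -[i j]; rewrite inE -(inord_val i).
have [|/fullS->//] := leqP n.+2 i; rewrite leq_eqVlt ltnNge -ltnS ltn_ord orbF.
move=> /eqP<-; have [->|jn] := eqVneq j (o n.+2); first exact: diagA.
(* Both adjacent layers are full, so the diagonal seed alone supplies the third neighbour. *)
apply: (close3 _ (o n.+1, j) (o 0, j) (o n.+2, o n.+2)) => //.
- exact: fullS.
- by rewrite /= !inE !xpair_eqE -!val_eqE /= !inordK; lia.
- by case: (adjS n.+1 j).
- apply/orP; right; apply/andP; split=> //.
  by rewrite /= /cycle_adj /= neqo //= !inordK // modnn eqxx.
- exact: adjK.
Qed.

End Construction.

Theorem theorem7 (n : nat) (hn : 3 <= n) :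
  dyn 3 (cartesian_product (cycle_graph n) (complete_graph n)) = n + 1.
Proof.
case: n hn => [|[|[|n]]] // _.
apply: dyn_eq (diagonal_seed_dynamic_monopoly n) (card_diagonal_seed n) _ => A Amono.
rewrite addn1 -[X in X < _](card_ord n.+3).
by apply: dynamic_monopoly_card_gt => //; [exact: cycle_degree|rewrite card_ord].
Qed.
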